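(* Let $\Bbbk$ be a field. For any finite simple graph $G$, the following equality of ideals in $\Bbbk[x_i,y_i:i\in V(G)]$ holds: \[ \mathcal{I}_G=\mathcal{J}_G\cap\bigcap_{i\in V(G)}\left(\mathcal{I}_G+\mathfrak{m}_{\{i\}}\right). \]
   Context: $V(G)$ and $E(G)$ denote the vertex and edge sets of $G$. The parity binomial edge ideal of $G$ is $\mathcal{I}_G=\langle x_ix_j-y_iy_j:\{i,j\}\in E(G)\rangle\subseteq\Bbbk[x_i,y_i:i\in V(G)]$. Further, $\mathcal{J}_G:=\mathcal{I}_G:\bigl(\prod_{i\in V(G)}x_iy_i\bigr)^\infty$ and $\mathfrak{m}_{\{i\}}:=\langle x_i,y_i\rangle$. *)

(* Defs.v *)
From HB Require Import structures.
From mathcomp Require Import all_boot all_order all_algebra.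
From mathcomp Require Import mpoly.

Set Implicit Arguments.
Unset Strict Implicit.
Unset Printing Implicit Defensive.

Import GRing.Theory.
Local Open Scope ring_scope.

(* Ideals are Prop-valued predicates (not the boolean [idealr] predicates):
   membership in a generated ideal is an existential statement. *)
Section Ideals.
Variable R : comNzRingType.
Implicit Types (S A B : R -> Prop) (f p : R).

Definition ideal_gen S p : Prop :=
  exists (m : nat) (c g : 'I_m -> R),
    (forall l, S (g l)) /\ p = \sum_(l < m) c l * g l.

Definition ideal_add A B p : Prop :=
  exists a b : R, [/\ A a, B b & p = a + b].

(* A : f^oo *)
Definition ideal_sat A f p : Prop := exists n : nat, A (p * f ^+ n).

End Ideals.

(* k[x_i, y_i : i in V]: of the 2|V| variables, the first |V| are the x_i and
   the last |V| are the y_i, with V numbered by enum_rank. *)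
Notation xy_ring k V := ({mpoly k[#|V| + #|V|]}) (only parsing).

Section ParityBinomialEdgeIdeal.
Variables (k : fieldType) (V : finType).

Definition varx (i : V) : xy_ring k V := 'X_(lshift #|V| (enum_rank i)).
Definition vary (i : V) : xy_ring k V := 'X_(rshift #|V| (enum_rank i)).

Definition parity_ideal (E : rel V) : xy_ring k V -> Prop :=
  ideal_gen (fun g => exists i j : V,
    E i j /\ g = varx i * varx j - vary i * vary j).

Definition parity_sat (E : rel V) : xy_ring k V -> Prop :=
  ideal_sat (parity_ideal E) (\prod_(i : V) (varx i * vary i)).

Definition vertex_ideal (i : V) : xy_ring k V -> Prop :=
  ideal_gen (fun g => g = varx i \/ g = vary i).

End ParityBinomialEdgeIdeal.

(* Main.v *)
Require Import Defs.
From HB Require Import structures.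
From mathcomp Require Import all_boot all_order all_algebra.
From mathcomp Require Import mpoly.
From mathcomp Require Import zify boolp.

Set Implicit Arguments.
Unset Strict Implicit.
Unset Printing Implicit Defensive.

Import GRing.Theory.
Local Open Scope ring_scope.

(** The ideal I_G is spanned by differences of monomials, so it is governed by
    the congruence that it induces on monomials, and everything comes down to
    one combinatorial fact: this congruence is cancellative on the monomials
    that involve every vertex.

    Write a variable as a signed vertex (v, s), with (v, true) for x_v and
    (v, false) for y_v; let bar exchange x_v and y_v.  A generator allows
    x_u x_v to be replaced by y_u y_v and conversely.  Along an edge of the
    signed double cover of G, which joins (u, s) to (v, ~~ s) when u and v are
    adjacent in G, this is the exchange of p * bar q for bar p * q, called the
    flip from p to q.  The flip still makes sense when p and q are only joined
    by a walk in the double cover.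

    - A flip along a walk is a congruence modulo I_G as soon as the monomial
      involves every vertex ([walk_flip]): the walk is cut at an intermediate
      vertex w, and whichever of x_w and y_w divides the monomial decides which
      half of the walk can be performed first.
    - If m * out = m' * in, where out and in are the total output and
      input of a list of flips, and m has full support, then m and m' are
      congruent ([flips_mcong]): either the first flip applies to m, or another
      flip of the list supplies what it lacks and the two can be concatenated.

    The relation of having such a list of flips, [mequiv], contains the
    congruence of I_G and is stable under multiplication and cancellation.
    Hence if f * X^M lies in I_G, the coefficients of f sum to 0 on each class
    of [mequiv]; when all monomials of f have full support, [flips_mcong] then
    puts f in I_G ([unsaturate]).

    It remains to reach full support.  The ideal I_G is homogeneous for the
    grading by the degrees deg_v in {x_v, y_v}, so membership of f in
    I_G + m_v says that the part of f of degree 0 at v lies in I_G.  Removing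
    these parts one vertex after another changes f by an element of I_G
    ([full_support_part]). *)

(** * Generated ideals *)

Section GeneratedIdeals.
Variable R : comNzRingType.
Implicit Types (S : R -> Prop) (f p q : R).

Lemma ideal_gen0 S : ideal_gen S 0.
Proof.
exists 0%N, (fun=> 0), (fun=> 0); split; first by case.
by rewrite big_ord0.
Qed.

Lemma ideal_gen_mem S g : S g -> ideal_gen S g.
Proof.
move=> Sg; exists 1%N, (fun=> 1), (fun=> g); split=> //.
by rewrite big_ord1 mul1r.
Qed.

Lemma ideal_genD S p q : ideal_gen S p -> ideal_gen S q -> ideal_gen S (p + q).
Proof.
move=> [m1 [c1 [g1 [S1 ->]]]] [m2 [c2 [g2 [S2 ->]]]].
pose glue T (a : 'I_m1 -> T) (b : 'I_m2 -> T) l :=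
  match split l with inl i => a i | inr j => b j end.
exists (m1 + m2)%N, (glue _ c1 c2), (glue _ g1 g2); split=> [l|].
  by rewrite /glue; case: split.
rewrite big_split_ord; congr (_ + _); apply: eq_bigr => i _; rewrite /glue.
  by rewrite -[lshift _ _]/(unsplit (inl i)) unsplitK.
by rewrite -[rshift _ _]/(unsplit (inr i)) unsplitK.
Qed.

Lemma ideal_genM S f p : ideal_gen S p -> ideal_gen S (f * p).
Proof.
move=> [m [c [g [Sg ->]]]]; exists m, (fun l => f * c l), g; split=> //.
by rewrite mulr_sumr; apply: eq_bigr => l _; rewrite mulrA.
Qed.

Lemma ideal_genB S p q : ideal_gen S p -> ideal_gen S q -> ideal_gen S (p - q).
Proof.
by move=> Ip Iq; apply: ideal_genD => //; rewrite -mulN1r; apply: ideal_genM.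
Qed.

End GeneratedIdeals.

(** * Linear maps prescribed on monomials *)

Section LinearExtension.
Variables (k : fieldType) (n : nat).
Implicit Types (w : 'X_{1..n} -> {mpoly k[n]}) (p q : {mpoly k[n]}).

Definition linext w p : {mpoly k[n]} := \sum_(m <- msupp p) p@_m *: w m.

(** Summing over a larger set of monomials makes the sum additive in the
    polynomial, as the range no longer depends on the polynomial. *)
Lemma linext_widen w p (s : seq 'X_{1..n}) : uniq s -> {subset msupp p <= s} ->
  linext w p = \sum_(m <- s) p@_m *: w m.
Proof.
move=> s_uniq sub; rewrite (bigID (mem (msupp p))) /= [X in _ + X]big1 ?addr0.
  rewrite -big_filter; apply/perm_big/uniq_perm; rewrite ?msupp_uniq ?filter_uniq //.
  by move=> m; rewrite mem_filter; case: (boolP (m \in _)) => //= /sub ->.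
by move=> m /memN_msupp_eq0 ->; rewrite scale0r.
Qed.

Lemma linext_is_linear w : linear (linext w).
Proof.
move=> c p q; pose s := undup (msupp (c *: p + q) ++ msupp p ++ msupp q).
have s_uniq : uniq s by apply: undup_uniq.
rewrite !(@linext_widen w _ s) //; first last.
- by move=> m; rewrite mem_undup !mem_cat => ->.
- by move=> m; rewrite mem_undup !mem_cat => ->; rewrite orbT.
- by move=> m; rewrite mem_undup !mem_cat => ->; rewrite !orbT.
rewrite scaler_sumr -big_split; apply: eq_bigr => m _ /=.
by rewrite mcoeffD mcoeffZ scalerDl scalerA.
Qed.

HB.instance Definition _ w :=
  GRing.isLinear.Build k {mpoly k[n]} {mpoly k[n]} _ (linext w)
    (linext_is_linear w).

Lemma linextX w m : linext w 'X_[m] = w m.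
Proof. by rewrite /linext msuppX big_seq1 mcoeffX eqxx scale1r. Qed.

Lemma linext_mulX w p m :
  linext w (p * 'X_[m]) = \sum_(a <- msupp p) p@_a *: w (a + m)%MM.
Proof.
rewrite {1}(mpolyE p) mulr_suml raddf_sum; apply: eq_bigr => a _.
by rewrite -scalerAl -mpolyXD /= linearZ /= linextX.
Qed.

End LinearExtension.

Section Graph.
Variables (k : fieldType) (V : finType) (E : rel V).
Hypotheses (E_sym : ssrbool.symmetric E) (E_irr : irreflexive E).

Local Notation n := (#|V| + #|V|)%N.
Local Notation mon := 'X_{1..n}.
Local Notation I := (@parity_ideal k V E).
Implicit Types (p q r : V * bool) (m c : mon) (u v : V).

(** * Signed vertices and monomials *)

Definition idx p : 'I_n :=
  if p.2 then lshift #|V| (enum_rank p.1) else rshift #|V| (enum_rank p.1).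

Definition bar p : V * bool := (p.1, ~~ p.2).

Definition evar p : mon := U_(idx p)%MM.

Definition vdeg m v : nat := (m (idx (v, true)) + m (idx (v, false)))%N.

Definition full_support m : Prop := forall v, (0 < vdeg m v)%N.

Lemma barK : involutive bar.
Proof. by case=> v s; rewrite /bar /= negbK. Qed.

Lemma bar_eq p q : (bar p == bar q) = (p == q).
Proof. exact: (inj_eq (inv_inj barK)). Qed.

Lemma bar_neq p : (bar p == p) = false.
Proof. by case: p => v []; rewrite /bar xpair_eqE eqxx. Qed.

Lemma idx_inj : injective idx.
Proof.
case=> u s [v t]; rewrite /idx /=; case: s; case: t.
- by move/lshift_inj/enum_rank_inj => ->.
- by move/eqP; rewrite eq_lrshift.
- by move/eqP; rewrite eq_rlshift.
- by move/rshift_inj/enum_rank_inj => ->.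
Qed.

Lemma idx_surj (i : 'I_n) : exists p, i = idx p.
Proof.
case: (split_ordP i) => j ->.
  by exists (enum_val j, true); rewrite /idx /= enum_valK.
by exists (enum_val j, false); rewrite /idx /= enum_valK.
Qed.

Lemma evarE p q : evar p (idx q) = (p == q) :> nat.
Proof. by rewrite /evar mnm1E (inj_eq idx_inj). Qed.

Lemma vdegD m c v : vdeg (m + c)%MM v = (vdeg m v + vdeg c v)%N.
Proof. by rewrite /vdeg !mnmDE; lia. Qed.

Lemma vdeg_evar p v : vdeg (evar p) v = (p.1 == v) :> nat.
Proof.
by rewrite /vdeg !evarE; case: p => u s; rewrite !xpair_eqE /=; case: s; lia.
Qed.

Lemma vdeg_point m v : (0 < vdeg m v)%N -> exists s, (0 < m (idx (v, s)))%N.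
Proof.
rewrite /vdeg; case: (posnP (m (idx (v, true)))) => [->|]; last by exists true.
by exists false.
Qed.

Lemma evar_split m p : (0 < m (idx p))%N -> exists c, m = (c + evar p)%MM.
Proof.
move=> m_p; exists (m - evar p)%MM; rewrite submK //.
apply/mnm_lepP=> i; have [q ->] := idx_surj i; rewrite evarE.
by case: eqP => [<-|].
Qed.

(** * Congruence of monomials modulo the ideal *)

Definition mcong m c : Prop := I ('X_[m] - 'X_[c]).

Lemma mcong_refl m : mcong m m.
Proof. by rewrite /mcong subrr; apply: ideal_gen0. Qed.

Lemma mcong_trans c m m' : mcong m c -> mcong c m' -> mcong m m'.
Proof.
rewrite /mcong => mc cm'.
by rewrite -(subrKA 'X_[c]); apply: ideal_genD.
Qed.

Lemma mcong_addl c m m' : mcong m m' -> mcong (c + m)%MM (c + m')%MM.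
Proof. by rewrite /mcong !mpolyXD -mulrBr; apply: ideal_genM. Qed.

Lemma X_evar p : 'X_[evar p] = (if p.2 then varx k p.1 else vary k p.1).
Proof. by rewrite /evar /idx /varx /vary; case: p.2. Qed.

Lemma mcong_edge u v s : E u v ->
  mcong (evar (u, s) + evar (v, s))%MM (evar (u, ~~ s) + evar (v, ~~ s))%MM.
Proof.
move=> Euv; rewrite /mcong !mpolyXD !X_evar /=.
have gen : I (varx k u * varx k v - vary k u * vary k v).
  by apply: ideal_gen_mem; exists u, v.
by case: s => //=; rewrite -opprB -mulN1r; apply: ideal_genM.
Qed.

(** * Flips along walks of the signed double cover *)

(** An edge preserves the sign of both variables that it exchanges; twisting
    the sign along the walk makes consecutive exchanges at a vertex cancel, so
    that a walk acts on its two ends only. *)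
Definition cover : rel (V * bool) :=
  fun p q => E p.1 q.1 && (q.2 == ~~ p.2).

Lemma cover_sym : ssrbool.symmetric cover.
Proof. by move=> [u s] [v t]; rewrite /cover /= E_sym; case: s; case: t. Qed.

Lemma cover_bar p q : cover (bar p) (bar q) = cover p q.
Proof. by case: p => u []; case: q => v []. Qed.

Lemma connect_coverC p q : connect cover p q = connect cover q p.
Proof. exact: sym_connect_sym cover_sym p q. Qed.

Lemma connect_bar p q : connect cover p q -> connect cover (bar q) (bar p).
Proof.
move=> /connectP [l path_l ->]; rewrite connect_coverC.
apply/connectP; exists (map bar l); last by rewrite last_map.
by rewrite path_map (eq_path (e' := cover)) // => x y; apply: cover_bar.
Qed.

Definition flip_in p q : mon := (evar p + evar (bar q))%MM.
Definition flip_out p q : mon := (evar (bar p) + evar q)%MM.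

Lemma vdeg_flip p q v : vdeg (flip_out p q) v = vdeg (flip_in p q) v.
Proof. by rewrite !vdegD !vdeg_evar. Qed.

(** The intermediate monomials of the obvious sequence of edge moves may fail
    to exist.  If the walk visits a vertex [r] other than its ends, then the
    full support hypothesis provides one of the two variables at [r] as a
    factor of [c]; the variable [r] itself makes the second half of the walk
    available, and [bar r] the first half, and each half returns what the other
    one needs.  It suffices to look for [r] among the first two vertices after
    [p]: if both are ends, then the walk has come back to [p] and can be
    shortened.  Intermediate vertices equal to an end have to be avoided, since
    there the variable may be present only because of the flip itself. *)
Lemma walk_flip l p c : path cover p l ->
  full_support (c + flip_in p (last p l))%MM ->
  mcong (c + flip_in p (last p l))%MM (c + flip_out p (last p l))%MM.
Proof.
have [N le_N] := ubnP (size l); elim: N l le_N p c => // N IH l le_N p c.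
have split_walk l1 l2 r : (size l1 < size l)%N -> (size l2 < size l)%N ->
    path cover p l1 -> last p l1 = r -> path cover r l2 -> last r l2 = last p l ->
    r.1 != p.1 -> r.1 != (last p l).1 ->
    full_support (c + flip_in p (last p l))%MM ->
    mcong (c + flip_in p (last p l))%MM (c + flip_out p (last p l))%MM.
  move=> lt1 lt2 path1 last1 path2 last2; set q := last p l in last2 *.
  move=> rp rq full_c.
  have [s c_r] : exists s, (0 < c (idx (r.1, s)))%N.
    apply: vdeg_point; have := full_c r.1.
    rewrite !vdegD !vdeg_evar /= eq_sym (negbTE rp) eq_sym (negbTE rq).
    by rewrite !addn0.
  have [c' def_c] := evar_split c_r.
  have walk1 c1 : full_support (c1 + flip_in p r)%MM ->
      mcong (c1 + flip_in p r)%MM (c1 + flip_out p r)%MM.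
    by rewrite -last1 => full1; apply: IH => //; apply: leq_trans lt1 le_N.
  have walk2 c1 : full_support (c1 + flip_in r q)%MM ->
      mcong (c1 + flip_in r q)%MM (c1 + flip_out r q)%MM.
    by rewrite -last2 => full1; apply: IH => //; apply: leq_trans lt2 le_N.
  (* [r] divides [c]: the half from [r] to [q] goes first *)
  case: (eqVneq s r.2) => [s_r | s_r].
    have def_s : (r.1, s) = r by rewrite s_r; case: (r).
    rewrite def_s in def_c.
    have e0 : (c + flip_in p q = (c' + evar p) + flip_in r q)%MM.
      by apply/mnmP=> i; rewrite def_c !mnmDE; lia.
    have e1 : (c' + evar p + flip_out r q = c' + evar q + flip_in p r)%MM.
      by apply/mnmP=> i; rewrite !mnmDE; lia.
    have e2 : (c + flip_out p q = (c' + evar q) + flip_out p r)%MM.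
      by apply/mnmP=> i; rewrite def_c !mnmDE; lia.
    have full1 : full_support (c' + evar q + flip_in p r)%MM.
      move=> v; have := full_c v; rewrite -e1 e0.
      by rewrite !(vdegD (_ + _)) vdeg_flip.
    rewrite e0 e2; apply: (@mcong_trans (c' + evar p + flip_out r q)%MM).
      by apply: walk2; rewrite -e0.
    by rewrite e1; apply: walk1.
  (* [bar r] divides [c]: the half from [p] to [r] goes first *)
  have def_s : (r.1, s) = bar r.
    by move: s_r; rewrite /bar; case: (r) => a []; case: s {c_r def_c}.
  rewrite def_s in def_c.
  have e0 : (c + flip_in p q = (c' + evar (bar q)) + flip_in p r)%MM.
    by apply/mnmP=> i; rewrite def_c !mnmDE; lia.
  have e1 : (c' + evar (bar q) + flip_out p r = c' + evar (bar p) + flip_in r q)%MM.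
    by apply/mnmP=> i; rewrite !mnmDE; lia.
  have e2 : (c + flip_out p q = (c' + evar (bar p)) + flip_out r q)%MM.
    by apply/mnmP=> i; rewrite def_c !mnmDE; lia.
  have full1 : full_support (c' + evar (bar p) + flip_in r q)%MM.
    move=> v; have := full_c v; rewrite -e1 e0.
    by rewrite !(vdegD (_ + _)) vdeg_flip.
  rewrite e0 e2; apply: (@mcong_trans (c' + evar (bar q) + flip_out p r)%MM).
    by apply: walk1; rewrite -e0.
  by rewrite e1; apply: walk2.
case: l le_N split_walk => [|a [|b l]] le_N split_walk.
- move=> _ _ /=; rewrite /flip_in /flip_out addmC [X in mcong _ X]addmC.
  by rewrite [(evar p + _)%MM]addmC; apply: mcong_refl.
- rewrite /= andbT => /andP [Epa /eqP a2] _; apply: mcong_addl.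
  have := mcong_edge p.2 Epa.
  by rewrite /flip_in /flip_out /bar a2 negbK -a2 -!surjective_pairing.
move=> /= /and3P [pa ab path_l].
have walk_b : path cover p [:: a; b] by rewrite /= pa ab.
have [Epa /eqP a2] := andP pa; have [Eab /eqP b2] := andP ab.
have ap : a.1 != p.1 by apply: contraTneq Epa => ->; rewrite E_irr.
have ba : b.1 != a.1 by apply: contraTneq Eab => ->; rewrite E_irr.
case: (eqVneq a.1 (last b l).1) => [aq | aq]; last first.
  by apply: (@split_walk [:: a] (b :: l) a) => //=; rewrite ?andbT ?pa ?ab.
case: (eqVneq b.1 p.1) => [bp | bp]; last first.
  apply: (@split_walk [:: a; b] l b); rewrite -?aq //=.
  by case: l path_l aq {le_N split_walk} => [_ /= aq|//]; rewrite aq eqxx in ba.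
(* the walk goes back and forth, [p], [a], [p], with [a] above the other end *)
have -> : last b l = last p l.
  by case: (l) aq ba => //= -> /eqP.
have def_b : b = p.
  by move: b2; rewrite a2 negbK; case: (b) (p) bp => [? ?] [? ?] /= -> ->.
by rewrite def_b in path_l; apply: IH => //=; move: le_N => /=; lia.
Qed.

(** * Composite flips *)

Definition flips_in (S : seq ((V * bool) * (V * bool))) : mon :=
  (\big[+%MM/0%MM]_(f <- S) flip_in f.1 f.2)%MM.
Definition flips_out (S : seq ((V * bool) * (V * bool))) : mon :=
  (\big[+%MM/0%MM]_(f <- S) flip_out f.1 f.2)%MM.
Definition flips_ok (S : seq ((V * bool) * (V * bool))) : bool :=
  all (fun f => connect cover f.1 f.2) S.

Lemma flips_in_cons f S : flips_in (f :: S) = (flip_in f.1 f.2 + flips_in S)%MM.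
Proof. by rewrite /flips_in big_cons. Qed.
Lemma flips_out_cons f S :
  flips_out (f :: S) = (flip_out f.1 f.2 + flips_out S)%MM.
Proof. by rewrite /flips_out big_cons. Qed.

(** A flip that outputs [r] can be moved to the front and oriented so as to end
    at [r]: the flips from [p] to [q] and from [bar q] to [bar p] have the same
    input and output. *)
Lemma flips_out_pop S r : flips_ok S -> (0 < flips_out S (idx r))%N ->
  exists a S', [/\ connect cover a r, flips_ok S', (size S' < size S)%N,
    flips_out S = (flip_out a r + flips_out S')%MM
    & flips_in S = (flip_in a r + flips_in S')%MM].
Proof.
elim: S => [|[a b] S IH] /=; first by rewrite /flips_out big_nil mnm0E.
move=> /andP [/= ab okS]; rewrite flips_out_cons flips_in_cons /=.
case: (posnP (flips_out S (idx r))) => [S_r | S_r _].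
  rewrite !mnmDE S_r !evarE => pos.
  have [br | br] := eqVneq b r.
    by exists a, S; rewrite -br; split=> //=.
  have ar : bar a = r by move: pos; rewrite (negbTE br); case: eqP.
  exists (bar b), S; rewrite -ar; split=> //=; first exact: connect_bar.
    by congr (_ + _)%MM; rewrite /flip_out barK addmC.
  by congr (_ + _)%MM; rewrite /flip_in barK addmC.
have [x [S' [xr okS' ltS' -> ->]]] := IH okS S_r.
exists x, ((a, b) :: S'); split=> //=; first by rewrite ab.
  by rewrite flips_out_cons /=; apply/mnmP=> i; rewrite !mnmDE; lia.
by rewrite flips_in_cons /=; apply/mnmP=> i; rewrite !mnmDE; lia.
Qed.

(** Induction on the number of flips.  If the first flip, from [p] to [q], does
    not apply to [m], then [m] has too few copies of an input [r] of that flip;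
    since [r] is consumed by the list, some other flip of the list outputs it.
    A flip ending at [r] and one starting at [r] concatenate, because
    [r] and [bar r] are then both consumed and produced. *)
Lemma flips_mcong S m m' : flips_ok S ->
  (m + flips_out S = m' + flips_in S)%MM -> full_support m -> mcong m m'.
Proof.
have [N le_N] := ubnP (size S); elim: N S le_N m => // N IH S le_N m.
case: S le_N => [|[p q] S] /= le_N.
  rewrite /flips_in /flips_out !big_nil => _ e _.
  by rewrite (@addIm _ 0%MM m m' e); apply: mcong_refl.
move=> /andP [/= pq okS]; rewrite flips_out_cons flips_in_cons /= => eq_m full_m.
have val_eq i : (m i + (flip_out p q i + flips_out S i)
                 = m' i + (flip_in p q i + flips_in S i))%N.
  by have := congr1 (fun x : mon => x i) eq_m; rewrite !mnmDE; lia.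
(* a flip from [p] to [p] does nothing *)
case: (eqVneq p q) => [def_p | neq_pq].
  apply: (IH S) => //; apply/mnmP=> i; have := val_eq i.
  by rewrite def_p !mnmDE; lia.
have merge r b : connect cover r b -> r != b ->
    flip_in r b = flip_in p q -> flip_out r b = flip_out p q ->
    (m (idx r) < flip_in p q (idx r))%N -> mcong m m'.
  move=> rb neq_rb in_eq out_eq m_r.
  have out_r : flip_out r b (idx r) = 0%N.
    by rewrite mnmDE !evarE bar_neq [b == r]eq_sym (negbTE neq_rb).
  have S_r : (0 < flips_out S (idx r))%N.
    by have := val_eq (idx r); rewrite -out_eq out_r; lia.
  have [a [S' [ar okS' ltS' outS inS]]] := flips_out_pop okS S_r.
  apply: (IH ((a, b) :: S')) => //=; first by lia.
    by rewrite okS' (connect_trans ar rb).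
  apply/mnmP=> i; have := val_eq i.
  by rewrite flips_out_cons flips_in_cons outS inS -in_eq -out_eq !mnmDE /=; lia.
case: (leqP (flip_in p q (idx p)) (m (idx p))) => [le_p | lt_p]; last first.
  exact: (merge p q).
case: (leqP (flip_in p q (idx (bar q))) (m (idx (bar q)))) => [le_q | lt_q].
  have def_m : m = (m - flip_in p q + flip_in p q)%MM.
    rewrite submK //; apply/mnm_lepP=> i; have [r ->] := idx_surj i.
    have [<-|pr] := eqVneq p r; first by [].
    have [<-|qr] := eqVneq (bar q) r; first by [].
    by rewrite mnmDE !evarE (negbTE pr) (negbTE qr).
  have [l path_l last_l] := connectP pq.
  apply: (@mcong_trans (m - flip_in p q + flip_out p q)%MM).
    by rewrite {1}def_m last_l; apply: walk_flip; rewrite -?last_l -?def_m.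
  apply: (IH S) => //.
    apply/mnmP=> i; have := val_eq i; have := congr1 (fun x : mon => x i) def_m.
    by rewrite !mnmDE mnmBE; lia.
  by move=> v; have := full_m v; rewrite {1}def_m !(vdegD (m - _)) vdeg_flip.
apply: (merge (bar q) (bar p)) => //; first exact: connect_bar.
- by rewrite bar_eq eq_sym.
- by rewrite /flip_in barK addmC.
- by rewrite /flip_out barK addmC.
Qed.

(** * Equivalence of monomials after saturation *)

(** Membership of the difference of the two monomials in the saturation, in a
    form from which cancellation is immediate. *)
Definition mequiv m m' : Prop :=
  exists2 S, flips_ok S & (m + flips_out S = m' + flips_in S)%MM.

Lemma mequiv_refl m : mequiv m m.
Proof. by exists [::]; rewrite // /flips_out /flips_in !big_nil. Qed.

Lemma mequiv_sym m m' : mequiv m m' -> mequiv m' m.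
Proof.
case=> S okS e; exists [seq (f.2, f.1) | f <- S].
  rewrite /flips_ok all_map; apply: sub_all okS => f /=.
  by rewrite connect_coverC.
rewrite /flips_out /flips_in !big_map /=.
under eq_bigr do rewrite /flip_out addmC -/(flip_in _ _).
under [X in _ = (_ + X)%MM]eq_bigr do rewrite /flip_in addmC -/(flip_out _ _).
exact: esym.
Qed.

Lemma mequiv_trans c m m' : mequiv m c -> mequiv c m' -> mequiv m m'.
Proof.
case=> [S okS eS] [T okT eT]; exists (S ++ T); first by rewrite /flips_ok all_cat; apply/andP.
rewrite /flips_out /flips_in !big_cat -/(flips_out S) -/(flips_out T).
rewrite -/(flips_in S) -/(flips_in T).
apply/mnmP=> i; move/mnmP/(_ i): eS; move/mnmP/(_ i): eT; rewrite !mnmDE /=; lia.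
Qed.

Lemma mequiv_addr c m m' : mequiv (m + c)%MM (m' + c)%MM <-> mequiv m m'.
Proof.
by split=> -[S okS e]; exists S => //; apply/mnmP=> i;
  move/mnmP/(_ i): e; rewrite !mnmDE; lia.
Qed.

Definition edge_mon u v s : mon := (evar (u, s) + evar (v, s))%MM.

Lemma mequiv_edge c u v : E u v ->
  mequiv (c + edge_mon u v true)%MM (c + edge_mon u v false)%MM.
Proof.
move=> Euv; exists [:: ((u, true), (v, false))].
  by rewrite /flips_ok /= andbT connect1 // /cover /= Euv.
rewrite flips_in_cons flips_out_cons /flips_in /flips_out !big_nil /=.
by rewrite /flip_in /flip_out /bar /=; apply/mnmP=> i; rewrite !mnmDE; lia.
Qed.

(** The decidability of the relation is classical here; choosing from the whole
    class makes the representative depend on the class only. *)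
Definition rep m : mon := choose (fun x => `[< mequiv m x >]) m.

Lemma rep_eq m m' : rep m = rep m' <-> mequiv m m'.
Proof.
have m_rep a : mequiv a (rep a).
  exact/asboolP/(chooseP (P := fun x => `[< mequiv a x >]))/asboolP/mequiv_refl.
split=> [e | mm'].
  by apply: (mequiv_trans (m_rep m)); rewrite e; apply/mequiv_sym.
rewrite /rep (@eq_choose _ _ (fun x => `[< mequiv m' x >])).
  by apply: choose_id; apply/asboolP => //; [apply: mequiv_sym | apply: mequiv_refl].
move=> x; apply/asboolP/asboolP => [mx | m'x].
  exact: mequiv_trans (mequiv_sym mm') mx.
exact: mequiv_trans mm' m'x.
Qed.

(** * Linear maps on the ideal *)

Lemma parity_idealZ a f : I f -> I (a *: f).
Proof. by rewrite -mul_mpolyC; apply: ideal_genM. Qed.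

(** The ideal is spanned by the differences of the two monomials
    [c + edge_mon u v true] and [c + edge_mon u v false], so a linear map only
    has to be examined on these. *)
Lemma linext_parity (A : {mpoly k[n]} -> Prop) (w : mon -> {mpoly k[n]}) f :
  A 0 -> (forall g h, A g -> A h -> A (g + h)) -> (forall a g, A g -> A (a *: g)) ->
  (forall c u v, E u v ->
     A (w (c + edge_mon u v true)%MM - w (c + edge_mon u v false)%MM)) ->
  I f -> A (linext w f).
Proof.
move=> A0 AD AZ Aw [N [c [g [gen_g ->]]]]; rewrite raddf_sum /=.
apply: big_ind => // l _; have [u [v [Euv ->]]] := gen_g l.
have -> : varx k u * varx k v - vary k u * vary k v =
    'X_[edge_mon u v true] - 'X_[edge_mon u v false].
  by rewrite !mpolyXD !X_evar.
rewrite mulrBr raddfB /= !linext_mulX -sumrB.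
by apply: big_ind => // a _; rewrite -scalerBr; apply/AZ/Aw.
Qed.

(** * Removing the monomials without full support *)

Definition vproj i : {mpoly k[n]} -> {mpoly k[n]} :=
  linext (fun m => if vdeg m i == 0%N then 'X_[m] else 0).

Lemma vproj_coef i f m :
  (vproj i f)@_m = if vdeg m i == 0%N then f@_m else 0.
Proof.
rewrite /vproj /linext raddf_sum /= [X in if _ then X@__ else _]mpolyE raddf_sum /=.
case: ifP => m_i; last first.
  apply: big1 => a _; rewrite mcoeffZ; case: ifP => a_i; last by rewrite mcoeff0 mulr0.
  rewrite mcoeffX; case: eqP => [am|_]; last by rewrite mulr0.
  by rewrite am m_i in a_i.
apply: eq_bigr => a _; rewrite !mcoeffZ; case: ifP => // a_i.
rewrite mcoeff0 mcoeffX; case: eqP => [am|//].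
by rewrite am m_i in a_i.
Qed.

(** Both monomials of a generator have the same degree at each vertex, so that
    the projection to degree 0 keeps or kills them together. *)
Lemma vproj_parity i f : I f -> I (vproj i f).
Proof.
apply: linext_parity => [|||c u v Euv].
- exact: ideal_gen0.
- exact: ideal_genD.
- exact: parity_idealZ.
rewrite !vdegD !vdeg_evar /=; case: ifP => _.
  by apply: mcong_addl; apply: mcong_edge.
by rewrite subrr; apply: ideal_gen0.
Qed.

Lemma vproj_vertex i f : @vertex_ideal k V i f -> vproj i f = 0.
Proof.
move=> [N [c [g [gen_g ->]]]]; rewrite /vproj raddf_sum /=.
apply: big1 => l _.
have [s ->] : exists s, g l = 'X_[evar (i, s)].
  by case: (gen_g l) => ->; [exists true | exists false]; rewrite X_evar.
rewrite linext_mulX; apply: big1 => a _.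
by rewrite vdegD vdeg_evar eqxx addn1 scaler0.
Qed.

(** For [f = a + b] with [a] in the ideal and [b] in m_i, the part of [f] of
    degree 0 at [i] is that of [a], which lies in the ideal. *)
Lemma full_support_part f :
  (forall i, ideal_add I (@vertex_ideal k V i) f) ->
  exists2 g, I (f - g) & forall m, m \in msupp g -> full_support m.
Proof.
move=> If.
suff [g Ig full_g] : exists2 g, I (f - g) &
    forall m, m \in msupp g -> forall i, i \in enum V -> (0 < vdeg m i)%N.
  by exists g => // m m_g i; apply: (full_g m) => //; rewrite mem_enum.
elim: (enum V) => [|i s [g Ig full_g]].
  by exists f => //; rewrite subrr; apply: ideal_gen0.
exists (g - vproj i g).
  have [a [b [Ia /vproj_vertex b0 def_f]]] := If i.
  have f_a : vproj i f = vproj i a.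
    by rewrite /vproj def_f raddfD /= -/(vproj i b) b0 addr0.
  have g_f : vproj i g = vproj i a - vproj i (f - g).
    by rewrite -f_a /vproj raddfB /= subKr.
  rewrite opprB addrCA addrC g_f.
  apply: ideal_genD => //; apply: ideal_genB; exact: vproj_parity.
move=> m; rewrite mcoeff_msupp mcoeffB vproj_coef => m_g j.
rewrite inE; case: (posnP (vdeg m i)) m_g => [_ | m_i]; first by rewrite subrr eqxx.
rewrite subr0 -mcoeff_msupp => m_g /predU1P[-> // | j_s].
exact: full_g.
Qed.

(** * Saturation *)

(** Sending each monomial [a] to the representative of the class of [a + M]
    kills [f].  By cancellation this groups the monomials of [f] by their own
    classes; within a class, full support makes them all congruent to the one
    that comes first in [msupp f]. *)
Lemma unsaturate f M : (forall m, m \in msupp f -> full_support m) ->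
  I (f * 'X_[M]) -> I f.
Proof.
move=> full_f IfM; pose key a := rep (a + M)%MM.
have key_sum : \sum_(a <- msupp f) f@_a *: 'X_[key a] = 0 :> {mpoly k[n]}.
  rewrite -(linext_mulX (fun m => 'X_[rep m])).
  apply: (linext_parity (A := eq^~ 0)) IfM => [//|g h -> ->|a g ->|c u v Euv].
  - by rewrite addr0.
  - by rewrite scaler0.
  - by apply/eqP; rewrite subr_eq0; apply/eqP; congr 'X_[_]; apply/rep_eq/mequiv_edge.
pose sec m := nth 0%MM (msupp f) (find (fun a => key a == m) (msupp f)).
have sec_sum : \sum_(a <- msupp f) f@_a *: 'X_[sec (key a)] = 0 :> {mpoly k[n]}.
  have := congr1 (linext (fun m => 'X_[sec m])) key_sum.
  rewrite raddf_sum raddf0 /= => e; rewrite -[RHS]e; apply: eq_bigr => a _.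
  by rewrite linearZ /= linextX.
have -> : f = \sum_(a <- msupp f) f@_a *: ('X_[a] - 'X_[sec (key a)]).
  under eq_bigr do rewrite scalerBr.
  by rewrite sumrB sec_sum subr0 -mpolyE.
rewrite big_seq.
apply: big_ind => [||a a_f]; [exact: ideal_gen0 | exact: ideal_genD |].
apply: parity_idealZ.
have has_key : has (fun b => key b == key a) (msupp f) by apply/hasP; exists a.
have /eqP/rep_eq/mequiv_addr/mequiv_sym [S okS e] := nth_find 0%MM has_key.
exact: flips_mcong okS e (full_f a a_f).
Qed.

Lemma parity_satP f : @parity_sat k V E f -> exists M, I (f * 'X_[M]).
Proof.
case=> N; set P := \prod_i _; suff [M ->] : exists M, P ^+ N = 'X_[M] by exists M.
suff [M ->] : exists M, P = 'X_[M] by exists (M *+ N)%MM; rewrite mpolyXn.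
apply: (big_ind (fun g : {mpoly k[n]} => exists M, g = 'X_[M])).
- by exists 0%MM; rewrite mpolyX0.
- by move=> _ _ [M1 ->] [M2 ->]; exists (M1 + M2)%MM; rewrite mpolyXD.
- by move=> i _; exists (evar (i, true) + evar (i, false))%MM; rewrite mpolyXD !X_evar.
Qed.

End Graph.

Theorem proposition5p4 (k : fieldType) (V : finType) (E : rel V)
    (E_sym : ssrbool.symmetric E) (E_irr : irreflexive E) :
  forall p : xy_ring k V,
    parity_ideal E p <->
    (parity_sat E p /\
     forall i : V, ideal_add (parity_ideal E) (vertex_ideal i) p).
Proof.
move=> p; split=> [Ip | [/parity_satP [M IpM] /full_support_part [q Ipq full_q]]].
  split=> [|i]; first by exists 0%N; rewrite expr0 mulr1.
  by exists p, 0; split; rewrite ?addr0 //; apply: ideal_gen0.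
rewrite -(subrK q p); apply: ideal_genD => //.
apply: (@unsaturate k V E E_sym E_irr q M full_q).
rewrite -[q](subKr p) mulrBl; apply: ideal_genB => //.
by rewrite mulrC; apply: ideal_genM.
Qed.
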